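(* Let $d\ge 1$ and let $\mathbf{f}$ be a $d\times d$ matrix-valued trigonometric polynomial with $\mathbf{f}\ge 0$ (i.e. $\mathbf{f}(\theta)$ is Hermitian positive semidefinite for all $\theta$), whose $0$-th Fourier coefficient $\hat{\mathbf{f}}_0$ is invertible. For $n\ge 1$ set $N=dn$ and $A_N:=\mathcal{C}_n(\mathbf{f})$, and let $$V_{n,\mathrm{post}}=I_N-\omega D_B^{-1}A_N,\qquad D_B=I_n\otimes\hat{\mathbf{f}}_0,$$ be the iteration matrix of the relaxed block Jacobi method applied to $A_N$, where $\omega$ is a real parameter. If $$0<\omega<\frac{2}{\left\|\hat{\mathbf{f}}_0^{-\frac12}\,\mathbf{f}\,\hat{\mathbf{f}}_0^{-\frac12}\right\|_\infty},$$ then there exists a positive value $a_{\mathrm{post}}$, independent of $n$, such that $$\|V_{n,\mathrm{post}}x\|_{A_N}^2\le\|x\|_{A_N}^2-a_{\mathrm{post}}\|x\|_{A_N^2}^2\qquad\text{for all }x\in\mathbb{C}^N.$$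
   Context: A $d\times d$ matrix-valued trigonometric polynomial is a finite sum $\mathbf{f}(\theta)=\sum_{|j|\le r}\hat{\mathbf{f}}_j e^{\iota j\theta}$, $\iota^2=-1$, with Fourier coefficients $\hat{\mathbf{f}}_j=\frac1{2\pi}\int_{-\pi}^{\pi}\mathbf{f}(\theta)e^{-\iota j\theta}\,d\theta\in\mathbb{C}^{d\times d}$. The block-circulant matrix of order $dn$ generated by $\mathbf{f}$ is $$\mathcal{C}_n(\mathbf{f})=(F_n\otimes I_d)\,\mathrm{diag}_{i=0,\dots,n-1}\big(\mathbf{f}(\theta_i^{(n)})\big)\,(F_n^H\otimes I_d),\qquad \theta_i^{(n)}=\frac{2\pi i}{n},$$ where the middle factor is block diagonal with blocks $\mathbf{f}(\theta_i^{(n)})$ and $F_n$ is the unitary Fourier matrix with entries $\frac1{\sqrt n}e^{-\iota r\theta_i^{(n)}}$, $r,i=0,\dots,n-1$. Here $\otimes$ is the Kronecker product. For a Hermitian positive semidefinite matrix $X$, $\|v\|_X=\|X^{1/2}v\|_2$. For a matrix-valued function $\mathbf{g}$, $\|\mathbf{g}\|_\infty=\mathrm{ess\,sup}_{\theta\in(-\pi,\pi)}\|\mathbf{g}(\theta)\|_2$, with $\|\cdot\|_2$ the spectral norm. *)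

(* Defs.v *)
From mathcomp Require Import all_boot all_order all_algebra.
From mathcomp Require Import complex mxtens.
From mathcomp Require Import all_classical all_reals all_analysis.
From mathcomp Require Import ess_sup_inf.

Set Implicit Arguments.
Unset Strict Implicit.
Unset Printing Implicit Defensive.

Import Order.TTheory GRing.Theory Num.Theory Num.Def.
Import numFieldNormedType.Exports.

Local Open Scope classical_set_scope.
Local Open Scope ring_scope.
Local Open Scope complex_scope.
Local Open Scope sesquilinear_scope.

Definition expi (R : realType) (t : R) : R[i] := cos t +i* sin t.

Definition trigpoly (R : realType) (d : nat) (f : R -> 'M[R[i]]_d) : Prop :=
  exists (r : nat) (c : int -> 'M[R[i]]_d), forall t : R,
    f t = \sum_(k < (2 * r).+1)
            expi ((k%:Z - r%:Z)%:~R * t) *: c (k%:Z - r%:Z).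

Definition cintegral (R : realType) (D : set R) (g : R -> R[i]) : R[i] :=
  (\int[@lebesgue_measure R]_(t in D) complex.Re (g t))
  +i* (\int[@lebesgue_measure R]_(t in D) complex.Im (g t)).

Definition fourier_coef (R : realType) (d : nat) (f : R -> 'M[R[i]]_d)
    (j : int) : 'M[R[i]]_d :=
  \matrix_(k, l) (((2 * pi)^-1)%:C *
    cintegral `[- pi, pi] (fun t => f t k l * expi (- (j%:~R * t)))).

Definition psdmx (R : realType) (m : nat) (X : 'M[R[i]]_m) : Prop :=
  X \is hermsymmx /\
  forall v : 'cV[R[i]]_m, 0 <= (v^t* *m X *m v) 0 0.

(* The square root [X^(1/2)] of a Hermitian positive semidefinite [X]
   ([sqrtmxP]), by functional calculus on a unitary diagonalization. *)
Definition sqrtmx (R : realType) (m : nat) (X : 'M[R[i]]_m) : 'M[R[i]]_m :=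
  invmx (spectralmx X) *m diag_mx (map_mx sqrtC (spectral_diag X))
    *m spectralmx X.

Lemma sqrtmxP (R : realType) (m : nat) (X : 'M[R[i]]_m) :
  psdmx X -> psdmx (sqrtmx X) /\ sqrtmx X *m sqrtmx X = X.
Proof.
move=> [Xh Xp]; set P := spectralmx X; set s := spectral_diag X.
have Pu : P \is unitarymx by exact: spectral_unitarymx.
have PU : P \in unitmx by exact: spectral_unit.
have XE : X = invmx P *m diag_mx s *m P.
  exact/orthomx_spectralP/hermitian_normalmx.
have s_ge0 i : 0 <= s 0 i.
  have := Xp (P^t* *m delta_mx i 0).
  rewrite XE invmx_unitary // trmx_mul map_mxM trmxCK.
  have PPt := unitarymxP Pu.
  rewrite !mulmxA -[_ *m P *m P^t*]mulmxA PPt mulmx1.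
  rewrite -[_ *m P *m P^t*]mulmxA PPt mulmx1.
  rewrite trmx_delta map_delta_mx -rowE -colE !mxE eqxx mulr1n.
  by [].
pose q := map_mx sqrtC s.
have q_ge0 i : 0 <= q 0 i by rewrite mxE sqrtC_ge0.
have SE : sqrtmx X = P^t* *m diag_mx q *m P.
  by rewrite /sqrtmx -/P -/s -/q invmx_unitary.
split; last first.
  rewrite SE -!mulmxA (mulmxA P) (unitarymxP Pu) mul1mx.
  rewrite [in RHS]XE invmx_unitary // -!mulmxA; congr (_ *m _).
  rewrite mulmxA; congr (_ *m _); rewrite mulmx_diag; congr diag_mx.
  by apply/rowP => i; rewrite !mxE -expr2 sqrtCK.
split.
  apply/is_hermitianmxP; rewrite expr0 scale1r SE !trmx_mul !map_mxM trmxCK.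
  rewrite mulmxA tr_diag_mx map_diag_mx; congr (_ *m diag_mx _ *m _).
  apply/rowP => i; rewrite [in RHS]mxE; exact/esym/CrealP/ger0_real/q_ge0.
move=> v; rewrite SE -!mulmxA mulmxA -map_mxM -trmx_mul.
rewrite mul_diag_mx !mxE sumr_ge0 // => i _.
rewrite !mxE mulrCA mulr_ge0 ?q_ge0 //.
  by have := q_ge0 i; rewrite mxE.
by rewrite mulrC mul_conjC_ge0.
Qed.

Definition norm2 (R : realType) (m : nat) (v : 'cV[R[i]]_m) : R :=
  Num.sqrt (\sum_i ComplexField.Normc.normc (v i 0) ^+ 2).

Definition norm_mx (R : realType) (m : nat) (X : 'M[R[i]]_m)
    (v : 'cV[R[i]]_m) : R :=
  norm2 (sqrtmx X *m v).

Definition spectral_norm (R : realType) (m : nat) (X : 'M[R[i]]_m) : R :=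
  sup [set norm2 (X *m v) | v in [set v : 'cV[R[i]]_m | norm2 v <= 1]].

Definition norm_infty (R : realType) (m : nat) (g : R -> 'M[R[i]]_m) : \bar R :=
  ess_sup (mrestr (@lebesgue_measure R)
             (measurable_itv (`]- pi, pi[ : interval R)))
    (fun t => (spectral_norm (g t))%:E).

Definition theta (R : realType) (n i : nat) : R := 2 * pi * i%:R / n%:R.

Definition fourier_mx (R : realType) (n : nat) : 'M[R[i]]_n :=
  \matrix_(r, i) (((Num.sqrt n%:R)^-1)%:C * expi (- (r%:R * theta R n i))).

(* [*t] is the Kronecker product, so the [i]-th summand is [B i] placed as the
   [i]-th diagonal block. *)
Definition block_diag (R : realType) (n d : nat) (B : 'I_n -> 'M[R[i]]_d) :
    'M[R[i]]_(n * d) :=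
  \sum_(i < n) delta_mx i i *t B i.

Definition block_circulant (R : realType) (n d : nat) (f : R -> 'M[R[i]]_d) :
    'M[R[i]]_(n * d) :=
  (fourier_mx R n *t 1%:M) *m block_diag (fun i : 'I_n => f (theta R n i))
    *m ((fourier_mx R n)^t* *t 1%:M).

Definition jacobi_post (R : realType) (n d : nat) (f : R -> 'M[R[i]]_d)
    (omega : R) : 'M[R[i]]_(n * d) :=
  let D_B := 1%:M *t fourier_coef f 0 : 'M[R[i]]_(n * d) in
  1%:M - omega%:C *: (invmx D_B *m block_circulant n f).

(* Main.v *)
Require Import Defs.
From mathcomp Require Import all_boot all_order all_algebra.
From mathcomp Require Import complex mxtens.
From mathcomp Require Import all_classical all_reals all_analysis.
From mathcomp Require Import ess_sup_inf.
From mathcomp Require Import ring lra.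

(** Write [D = 1 *t f0] with [f0] the zeroth Fourier coefficient, [A] for the
    block-circulant matrix, and [X <= Y] when [Y - X] is Hermitian positive
    semidefinite.  Everything follows from two matrix inequalities with
    constants that do not depend on [n]:

      [A <= M *: D]  and  [D <= lam *: 1].

    Put [y = D^-1 A x].  Expanding the square,
      [|V x|_A^2 = |x|_A^2 - 2 omega y^* D y + omega^2 y^* A y],
    and the first inequality bounds the last term by [omega^2 M y^* D y], so
    [|x|_A^2] drops by at least [omega (2 - omega M) y^* D y].  The second
    inequality gives [D D <= lam *: D], hence
      [|x|_(A A)^2 = |A x|^2 = |D y|^2 <= lam y^* D y],
    and [a_post = omega (2 - omega M) / lam] works.  This is
    [jacobi_smoothing].

    Both inequalities are inherited from [d x d] ones.  The Fourier matrix [F]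
    is unitary and [F *t 1] commutes with [D], so that [M *: D - A] is
    congruent to the block diagonal matrix with blocks
    [M *: f0 - f (theta_i)] ([jacobi_post_smoothing]).  It remains to show
    [f t <= M *: f0] for every [t] and some [M] with [omega M < 2]
    ([psd_symbol_bound]).  The hypothesis on [omega] bounds the spectral norm
    of [f0^(-1/2) f f0^(-1/2)] by such an [M] almost everywhere on
    [(-pi, pi)]; since [f] is continuous the bound holds at every point of the
    closed interval, and since [f] is [2 pi]-periodic it holds at all the grid
    points.  The square root of [f0] is meaningful because [f0], an average of
    the positive semidefinite matrices [f t], is itself positive semidefinite
    ([psd_fourier_coef0]). *)

Set Implicit Arguments.
Unset Strict Implicit.
Unset Printing Implicit Defensive.

Import Order.TTheory GRing.Theory Num.Theory.
Import numFieldNormedType.Exports.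

Local Open Scope ring_scope.
Local Open Scope complex_scope.
Local Open Scope sesquilinear_scope.

(** * Positive semidefinite matrices *)

Lemma hermsymmxE (R : realType) m (X : 'M[R[i]]_m) :
  (X \is hermsymmx) = (X == X^t* ).
Proof. by rewrite sesquiE expr0 scale1r. Qed.

Lemma trmxC_mul (R : realType) m n p (A : 'M[R[i]]_(m, n))
    (B : 'M[R[i]]_(n, p)) :
  (A *m B)^t* = B^t* *m A^t*.
Proof. by rewrite trmx_mul map_mxM. Qed.

Lemma norm2_sq (R : realType) m (v : 'cV[R[i]]_m) :
  (norm2 v ^+ 2)%:C = (v^t* *m v) 0 0.
Proof.
rewrite sqr_sqrtr ?sumr_ge0// => [|i _]; last exact: sqr_ge0.
rewrite rmorph_sum/= mxE; apply: eq_bigr => i _.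
rewrite !mxE mulrC -normCK rmorphXn.
by case: (v i 0).
Qed.

Lemma psd_gram (R : realType) m n (W : 'M[R[i]]_(m, n)) : psdmx (W^t* *m W).
Proof.
split; first by rewrite hermsymmxE trmxC_mul trmxCK.
move=> v; rewrite -!mulmxA mulmxA -trmxC_mul -norm2_sq.
by rewrite ler0c sqr_ge0.
Qed.

Lemma psdP (R : realType) m (X : 'M[R[i]]_m) :
  psdmx X -> exists2 S : 'M[R[i]]_m, S^t* = S & X = S *m S.
Proof.
by move=> /sqrtmxP[[+ _] <-]; rewrite hermsymmxE => /eqP SE; exists (sqrtmx X).
Qed.

Lemma norm_mx_sq (R : realType) m (X : 'M[R[i]]_m) v :
  psdmx X -> (norm_mx X v ^+ 2)%:C = (v^t* *m X *m v) 0 0.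
Proof.
move=> /sqrtmxP[[+ _] XE]; rewrite hermsymmxE => /eqP SE.
rewrite norm2_sq trmxC_mul -SE -[in RHS]XE.
by rewrite (mulmxA _ (sqrtmx X) v) (mulmxA _ (sqrtmx X) (sqrtmx X)).
Qed.

Lemma psd_congr (R : realType) m n (X : 'M[R[i]]_m) (W : 'M[R[i]]_(m, n)) :
  psdmx X -> psdmx (W^t* *m X *m W).
Proof.
move=> /psdP[S SE ->].
by have := psd_gram (S *m W); rewrite trmxC_mul SE !mulmxA.
Qed.

Lemma psd0 (R : realType) m : psdmx (0 : 'M[R[i]]_m).
Proof. by have := psd_gram (0 : 'M[R[i]]_m); rewrite mulmx0. Qed.

Lemma psdD (R : realType) m (X Y : 'M[R[i]]_m) :
  psdmx X -> psdmx Y -> psdmx (X + Y).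
Proof.
move=> [+ Xp] [+ Yp]; rewrite !hermsymmxE => /eqP Xh /eqP Yh; split.
  by rewrite hermsymmxE linearD/= map_mxD -Xh -Yh.
by move=> v; rewrite mulmxDr mulmxDl mxE addr_ge0.
Qed.

(** A diagonal block [S *m S] with [S] Hermitian is the Gram matrix of the
    same block filled with [S]; going through Gram matrices spares any
    decomposition of the vector into blocks. *)
Lemma psd_block_diag (R : realType) n d (B : 'I_n -> 'M[R[i]]_d) :
  (forall i, psdmx (B i)) -> psdmx (block_diag B).
Proof.
move=> Bp; rewrite /block_diag; elim/big_rec: _ => [|i X _ Xp].
  exact: psd0.
have [S SE BE] := psdP (Bp i).
apply: psdD; last exact: Xp.
rewrite BE -{1}(mul_delta_mx i i i) -tensmx_mul.
set W := delta_mx i i *t S.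
have WE : W^t* = W by rewrite /W trmx_tens map_mxT SE trmx_delta map_delta_mx.
by rewrite -[X in X *m W]WE; exact: psd_gram.
Qed.

(** Congruence of [l - X] by the square root of [X]. *)
Lemma psd_sandwich (R : realType) m (X : 'M[R[i]]_m) (l : R) :
  psdmx X -> psdmx (l%:C%:M - X) -> psdmx (l%:C *: X - X *m X).
Proof.
move=> /psdP[S SE ->] /(psd_congr S); rewrite SE.
by rewrite mulmxBr mulmxBl mul_mx_scalar -scalemxAl !mulmxA.
Qed.

Lemma qformB (C : numClosedFieldType) m (A : 'M[C]_m) (c : C) (x y : 'cV_m)
    (a b e g : C) :
  Num.conj c = c ->
  (x^t* *m A *m x) 0 0 = a -> (x^t* *m A *m y) 0 0 = b ->
  (y^t* *m A *m x) 0 0 = e -> (y^t* *m A *m y) 0 0 = g ->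
  ((x - c *: y)^t* *m A *m (x - c *: y)) 0 0 = a - c * b - c * (e - c * g).
Proof.
move=> cE <- <- <- <-.
have -> : (x - c *: y)^t* = x^t* - c *: y^t*.
  by rewrite linearB linearZ /= map_mxB map_mxZ; congr (_ - _ *: _).
rewrite !mulmxBl !mulmxBr -!scalemxAl -!scalemxAr.
set xx := x^t* *m A *m x; set xy := x^t* *m A *m y.
set yx := y^t* *m A *m x; set yy := y^t* *m A *m y.
by rewrite !mxE mulrBr.
Qed.

Lemma qform_scaleB (C : numClosedFieldType) m (X Y : 'M[C]_m) (c : C)
    (v : 'cV_m) :
  (v^t* *m (c *: X - Y) *m v) 0 0 =
  c * (v^t* *m X *m v) 0 0 - (v^t* *m Y *m v) 0 0.
Proof.
rewrite mulmxBr mulmxBl -scalemxAr -scalemxAl.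
by set a := v^t* *m X *m v; set b := v^t* *m Y *m v; rewrite !mxE.
Qed.

(** The scalar part of the smoothing estimate: [s], [p], [q], [r] stand for
    [x^* A x], [y^* D y], [y^* A y] and [x^* A A x], where [y = D^-1 A x]. *)
Lemma smoothing_arith (R : realFieldType) (v s r p q omega M lam : R) :
  0 <= omega -> omega * M <= 2 -> 0 < lam -> q <= M * p -> r <= lam * p ->
  v = s - omega * p - omega * (p - omega * q) ->
  v <= s - omega * (2 - omega * M) / lam * r.
Proof.
move=> omega0 omM lam0 qp rp ->.
have h1 := ler_wpM2l omega0 (ler_wpM2l omega0 qp).
have h2 : omega * (2 - omega * M) / lam * r <= omega * (2 - omega * M) * p.
  rewrite -!mulrA; apply: ler_wpM2l => //; apply: ler_wpM2l.
    by rewrite subr_ge0.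
  by rewrite ler_pdivrMl.
lra.
Qed.

(** The smoothing property for an arbitrary preconditioner [D].  All cross
    terms collapse to [y^* D y] because [D y = A x]. *)
Lemma jacobi_smoothing (R : realType) m (A D : 'M[R[i]]_m) (omega M lam : R) :
  psdmx A -> psdmx D -> D \in unitmx ->
  psdmx (M%:C *: D - A) -> psdmx (lam%:C%:M - D) -> 0 < lam ->
  0 <= omega -> omega * M <= 2 ->
  forall x : 'cV[R[i]]_m,
  norm_mx A ((1%:M - omega%:C *: (invmx D *m A)) *m x) ^+ 2 <=
  norm_mx A x ^+ 2 - omega * (2 - omega * M) / lam * norm_mx (A *m A) x ^+ 2.
Proof.
move=> Ap Dp Du MDA lD lam0 omega0 omM x.
have [/[1!hermsymmxE]/eqP Ah _] := Ap; have [/[1!hermsymmxE]/eqP Dh _] := Dp.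
have AAp : psdmx (A *m A) by rewrite [X in X *m _]Ah; exact: psd_gram.
pose y := invmx D *m A *m x.
have Dy : D *m y = A *m x by rewrite /y !mulmxA mulmxV// mul1mx.
have yD : y^t* *m D = x^t* *m A by rewrite [in LHS]Dh [in RHS]Ah -!trmxC_mul Dy.
have Vx : (1%:M - omega%:C *: (invmx D *m A)) *m x = x - omega%:C *: y.
  by rewrite mulmxBl mul1mx -scalemxAl.
rewrite Vx; clearbody y.
pose p := norm_mx D y ^+ 2; pose q := norm_mx A y ^+ 2.
pose r := norm_mx (A *m A) x ^+ 2; pose s := norm_mx A x ^+ 2.
have Ep : (y^t* *m D *m y) 0 0 = p%:C by rewrite norm_mx_sq.
have Eq : (y^t* *m A *m y) 0 0 = q%:C by rewrite norm_mx_sq.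
have Es : (x^t* *m A *m x) 0 0 = s%:C by rewrite norm_mx_sq.
have Er : (x^t* *m (A *m A) *m x) 0 0 = r%:C by rewrite norm_mx_sq.
have Er' : (y^t* *m (D *m D) *m y) 0 0 = r%:C.
  by rewrite (mulmxA _ D D) yD -(mulmxA _ D y) Dy -Er (mulmxA _ A A)
    (mulmxA _ A x).
have Exy : (x^t* *m A *m y) 0 0 = p%:C by rewrite -yD.
have Eyx : (y^t* *m A *m x) 0 0 = p%:C by rewrite -Ep -!mulmxA Dy.
have qp : q <= M * p.
  have [_ /(_ y)] := MDA; rewrite qform_scaleB Ep Eq.
  by rewrite subr_ge0 -rmorphM lecR.
have rp : r <= lam * p.
  have [_ /(_ y)] := psd_sandwich Dp lD.
  by rewrite qform_scaleB Ep Er' subr_ge0 -rmorphM lecR.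
apply: (@smoothing_arith _ _ s r p q) => //.
apply: complexI; rewrite (norm_mx_sq (x - omega%:C *: y) Ap).
have H := @qformB _ _ A _ x y _ _ _ _ (conjc_real omega) Es Exy Eyx Eq.
transitivity (s%:C - omega%:C * p%:C - omega%:C * (p%:C - omega%:C * q%:C)).
  exact: H.
clearbody s p q r.
clear.
by simpc.
Qed.

(** * Block-circulant matrices *)

Lemma expiD (R : realType) (a b : R) : expi (a + b) = expi a * expi b.
Proof. by rewrite /expi sinD cosD; simpc; rewrite [X in _ +i* X]addrC. Qed.

Lemma expi0 (R : realType) : expi 0 = 1 :> R[i].
Proof. by rewrite /expi sin0 cos0. Qed.

Lemma conj_expi (R : realType) (t : R) : Num.conj (expi t) = expi (- t).
Proof. by rewrite /expi sinN cosN. Qed.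

Lemma expiMn (R : realType) (t : R) k : expi (k%:R * t) = expi t ^+ k.
Proof.
elim: k => [|k IH]; first by rewrite mul0r expi0.
by rewrite -natr1 mulrDl mul1r expiD IH exprSr.
Qed.

Lemma expi_2pi (R : realType) : expi (2 * pi) = 1 :> R[i].
Proof.
by rewrite mulr_natl /expi cos2pi sin2pi.
Qed.

(** Otherwise [1 - cos t = 2 sin^2 (t / 2)] would vanish with
    [0 < |t| / 2 < pi]. *)
Lemma expi_neq1 (R : realType) (t : R) :
  t != 0 -> `|t| < 2 * pi -> expi t != 1.
Proof.
move=> t0 tpi; apply/negP => /eqP [c1 _].
pose u := `|t| / 2.
have u0 : 0 < sin u.
  by apply: sin_gt0_pi; rewrite divr_gt0 ?normr_gt0//= ltr_pdivrMr// mulrC.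
have : cos `|t| = 1 by case: (ger0P t) => _; rewrite ?cosN.
rewrite (_ : `|t| = u *+ 2); last by rewrite -mulr_natr divfK.
have := exprn_gt0 2 u0; rewrite cos_mulr2n sin2cos2 mulr2n.
lra.
Qed.

(** Off the diagonal, the entry is a geometric sum over the powers of an
    [n]-th root of unity [w <> 1], and [(w - 1) (1 + ... + w^(n-1)) = 0]. *)
Lemma fourier_mx_unitary (R : realType) n : (0 < n)%N ->
  fourier_mx R n *m (fourier_mx R n)^t* = 1%:M.
Proof.
move=> n0; apply/matrixP => r s; rewrite !mxE.
have n0' : n%:R != 0 :> R by rewrite pnatr_eq0 -lt0n.
pose w := expi ((s%:R - r%:R) * (2 * pi / n%:R)) : R[i].
have -> : \sum_j fourier_mx R n r j * (fourier_mx R n)^t* j s =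
   (n%:R^-1)%:C * \sum_(j < n) w ^+ j.
  rewrite mulr_sumr; apply: eq_bigr => j _; rewrite !mxE rmorphM.
  rewrite [X in _ * (_ * X)]conj_expi opprK mulrACA -expiD -expiMn.
  congr (_ * expi _).
    transitivity ((Num.sqrt n%:R)^-1 * (Num.sqrt n%:R)^-1 : R)%:C.
      by rewrite rmorphM; congr (_ * _); exact: conjc_real.
    by rewrite -invfM -expr2 sqr_sqrtr.
  by rewrite /theta; field.
case: (eqVneq r s) => [rs|rs].
  rewrite /w rs subrr mul0r expi0 (eq_bigr (fun=> 1)); last first.
    by move=> j _; exact: expr1n.
  rewrite sumr_const card_ord -(rmorph_nat (real_complex R)) -rmorphM.
  by rewrite mulVf.
have w1 : w != 1.
  have sr0 : s%:R - r%:R != 0 :> R by rewrite subr_eq0 eqr_nat eq_sym.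
  have pi0 := @pi_gt0 R; have n0R : 0 < n%:R :> R by rewrite ltr0n.
  apply: expi_neq1.
    by rewrite mulf_neq0// mulf_neq0 ?invr_eq0// gt_eqF// mulr_gt0.
  rewrite normrM (gtr0_norm (divr_gt0 _ _)) ?mulr_gt0//.
  rewrite mulrCA -[ltRHS]mulr1 ltr_pM2l ?mulr_gt0//.
  rewrite ltr_pdivrMr// mul1r ltr_norml.
  have := ltn_ord r; have := ltn_ord s; rewrite -!(ltr_nat R).
  have := ler0n R r; have := ler0n R s.
  by move=> ? ? ? ?; apply/andP; split; lra.
apply/eqP; rewrite mulf_eq0; apply/orP; right.
have w1' : w - 1 != 0 by rewrite subr_eq0.
rewrite -(mulrI_eq0 _ (mulfI w1')) -subrX1 subr_eq0; apply/eqP.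
have -> : w ^+ n = expi (s%:R * (2 * pi)) * expi (- (r%:R * (2 * pi))).
  by rewrite -expiMn -expiD; congr expi; field.
by rewrite -conj_expi !(expiMn (2 * pi)) expi_2pi !expr1n rmorph1 mulr1.
Qed.

Lemma trC_tens1 (R : realType) n d (F : 'M[R[i]]_n) :
  (F *t 1%:M : 'M[R[i]]_(n * d))^t* = F^t* *t 1%:M.
Proof. by rewrite trmx_tens map_mxT trmx1 map_mx1. Qed.

Lemma tens11 (R : realType) n d : (1%:M *t 1%:M : 'M[R[i]]_(n * d)) = 1%:M.
Proof.
apply/matrixP => i j; case: (mxtens_indexP i) => a b.
case: (mxtens_indexP j) => a' b'.
rewrite tensmxE !mxE (can_eq (@mxtens_indexK n d)) xpair_eqE.
by case: (a == a'); rewrite ?mul1r ?mul0r.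
Qed.

Lemma block_diag_const (R : realType) n d (X : 'M[R[i]]_d) :
  block_diag (fun _ : 'I_n => X) = 1%:M *t X.
Proof.
apply/matrixP => i j; rewrite /block_diag summxE mxE.
under eq_bigr do rewrite mxE.
rewrite -mulr_suml; congr (_ * _).
rewrite !mxE (bigD1 (mxtens_unindex i).1)//= !mxE eqxx/= big1 ?addr0.
  by rewrite eq_sym.
by move=> k /negPf kn; rewrite mxE eq_sym kn.
Qed.

Lemma block_diag_scaleB (R : realType) n d (c : R[i])
    (X Y : 'I_n -> 'M[R[i]]_d) :
  c *: block_diag X - block_diag Y = block_diag (fun i => c *: X i - Y i).
Proof.
rewrite /block_diag scaler_sumr -sumrB; apply: eq_bigr => i _.
apply/matrixP => k l; rewrite !mxE mulrBr; congr (_ - _); exact: mulrCA.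
Qed.

(** Congruence by [F *t 1] reduces the two inequalities between matrices of
    order [n * d] to inequalities between their diagonal blocks; unitarity of
    [F] is what makes [1 *t f0] block diagonal in the same basis as the
    block-circulant matrix. *)
Lemma jacobi_post_smoothing (R : realType) n d (f : R -> 'M[R[i]]_d)
    (omega M lam : R) :
  (0 < n)%N -> (0 < d)%N ->
  let f0 := fourier_coef f 0 in
  (forall t, psdmx (f t)) -> psdmx f0 -> f0 \in unitmx ->
  (forall i : 'I_n, psdmx (M%:C *: f0 - f (theta R n i))) ->
  psdmx (lam%:C%:M - f0) ->
  0 < lam -> 0 <= omega -> omega * M <= 2 ->
  forall x : 'cV[R[i]]_(n * d),
  norm_mx (block_circulant n f) (jacobi_post n f omega *m x) ^+ 2 <=
  norm_mx (block_circulant n f) x ^+ 2 - omega * (2 - omega * M) / lam *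
     norm_mx (block_circulant n f *m block_circulant n f) x ^+ 2.
Proof.
move=> n0 d0 f0 fp f0p f0u Mf lf lam0 omega0 omM.
pose F := fourier_mx R n *t 1%:M : 'M[R[i]]_(n * d).
have AE : block_circulant n f =
    F^t*^t* *m block_diag (fun i : 'I_n => f (theta R n i)) *m F^t*.
  by rewrite trmxCK trC_tens1.
have DE : 1%:M *t f0 = F^t*^t* *m block_diag (fun i : 'I_n => f0) *m F^t*.
  by rewrite trmxCK trC_tens1 block_diag_const !tensmx_mul !mulmx1 !mul1mx
     fourier_mx_unitary.
apply: (@jacobi_smoothing _ _ _ (1%:M *t f0)) => //.
- rewrite AE; apply: psd_congr; apply: psd_block_diag => i; exact: fp.
- by rewrite -block_diag_const; apply: psd_block_diag => i; exact: f0p.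
- by apply: tensmx_unit; rewrite -?lt0n// unitmx1.
- rewrite AE DE scalemxAl scalemxAr -mulmxBl -mulmxBr block_diag_scaleB.
  apply: psd_congr; apply: psd_block_diag => i; exact: Mf.
- rewrite -(scalemx1 _ lam%:C) -tens11 -!block_diag_const.
  rewrite block_diag_scaleB; apply: psd_block_diag => i.
  by rewrite scalemx1.
Qed.

(** * The spectral norm and the order of Hermitian matrices *)

Lemma norm2_ge0 (R : realType) m (v : 'cV[R[i]]_m) : 0 <= norm2 v.
Proof. exact: sqrtr_ge0. Qed.

Lemma norm2_eq0 (R : realType) m (v : 'cV[R[i]]_m) : norm2 v = 0 -> v = 0.
Proof.
move=> /eqP; rewrite sqrtr_eq0 => v0; apply/colP => i; rewrite mxE.
apply: ComplexField.Normc.eq0_normc; apply/eqP.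
rewrite -sqrf_eq0 eq_le sqr_ge0 andbT.
apply: le_trans v0; rewrite (bigD1 i)//= lerDl sumr_ge0// => j _.
exact: sqr_ge0.
Qed.

Lemma norm2Z (R : realType) m (c : R) (v : 'cV[R[i]]_m) :
  0 <= c -> norm2 (c%:C *: v) = c * norm2 v.
Proof.
move=> c0; rewrite /norm2 -[in RHS](ger0_norm c0) -sqrtr_sqr -sqrtrM ?sqr_ge0//.
congr Num.sqrt; rewrite mulr_sumr; apply: eq_bigr => i _.
rewrite mxE ComplexField.Normc.normcM exprMn; congr (_ * _).
by rewrite /= expr0n/= addr0 sqr_sqrtr// sqr_ge0.
Qed.

Lemma normc_le_norm2 (R : realType) m (v : 'cV[R[i]]_m) i :
  ComplexField.Normc.normc (v i 0) <= norm2 v.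
Proof.
have n0 (z : R[i]) : 0 <= ComplexField.Normc.normc z.
  by case: z => a b; exact: sqrtr_ge0.
rewrite -[leLHS](ger0_norm (n0 _)) -sqrtr_sqr ler_wsqrtr// (bigD1 i)//=.
by rewrite lerDl sumr_ge0// => j _; exact: sqr_ge0.
Qed.

(** Makes the supremum defining the spectral norm a genuine one. *)
Lemma norm2_bounded (R : realType) m (X : 'M[R[i]]_m) :
  exists K : R, forall v, norm2 v <= 1 -> norm2 (X *m v) <= K.
Proof.
pose nc := @ComplexField.Normc.normc R.
have n0 (z : R[i]) : 0 <= nc z by case: z => a b; exact: sqrtr_ge0.
exists (Num.sqrt (\sum_i (\sum_j nc (X i j)) ^+ 2)) => v v1.
apply: ler_wsqrtr; apply: ler_sum => i _.
rewrite ler_sqr ?nnegrE ?sumr_ge0//.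
rewrite mxE; apply: (@le_trans _ _ (\sum_j nc (X i j * v j 0))).
  elim/big_ind2 : _ => [|x1 x2 y1 y2 h1 h2|//].
    by rewrite ComplexField.Normc.normc0.
  by apply: le_trans (lerD h1 h2); exact: le_normcD.
apply: ler_sum => j _; rewrite /nc ComplexField.Normc.normcM.
by rewrite ler_piMr// (le_trans _ v1)// normc_le_norm2.
Qed.

Lemma spectral_normP (R : realType) m (X : 'M[R[i]]_m) v :
  norm2 (X *m v) <= spectral_norm X * norm2 v.
Proof.
have sup_ub (w : 'cV[R[i]]_m) :
    norm2 w <= 1 -> norm2 (X *m w) <= spectral_norm X.
  move=> w1; apply: ub_le_sup; last by exists w.
  have [K KP] := norm2_bounded X.
  by exists K => _ [u u1 <-]; exact: KP.
have [v0|v0] := eqVneq (norm2 v) 0.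
  rewrite (norm2_eq0 v0) mulmx0 -(scale0r (0 : 'cV[R[i]]_m)).
  by rewrite norm2Z// !mul0r mulr0.
have vp : 0 < norm2 v by rewrite lt_neqAle eq_sym v0 norm2_ge0.
rewrite -ler_pdivrMr// mulrC.
have vi : 0 <= (norm2 v)^-1 by rewrite invr_ge0 norm2_ge0.
rewrite -norm2Z// scalemxAr; apply: sup_ub.
by rewrite norm2Z// mulVf.
Qed.

(** Expanding [0 <= |X v - M v|^2] and using [|X v|^2 <= M^2 |v|^2] gives
    [2 M v^* X v <= 2 M^2 |v|^2]. *)
Lemma psd_norm_bound (R : realType) m (X : 'M[R[i]]_m) (M : R) :
  X \is hermsymmx -> 0 < M -> (forall v, norm2 (X *m v) <= M * norm2 v) ->
  psdmx (M%:C%:M - X).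
Proof.
move=> /[1!hermsymmxE]/eqP Xh M0 XM; split.
  rewrite hermsymmxE; apply/eqP; rewrite linearB map_mxB/= -Xh.
  rewrite tr_scalar_mx map_scalar_mx; congr (_%:M - _).
  by apply/esym; exact: conjc_real.
move=> v; rewrite -scalemx1 qform_scaleB mulmx1 -norm2_sq.
set q := (v^t* *m X *m v) 0 0.
pose a := norm2 (X *m v); set b := norm2 v.
have E1 : ((X *m v)^t* *m 1%:M *m (X *m v)) 0 0 = (a ^+ 2)%:C.
  by rewrite mulmx1 norm2_sq.
have E2 : ((X *m v)^t* *m 1%:M *m v) 0 0 = q by rewrite mulmx1 trmxC_mul -Xh.
have E3 : (v^t* *m 1%:M *m (X *m v)) 0 0 = q by rewrite mulmx1 mulmxA.
have E4 : (v^t* *m 1%:M *m v) 0 0 = (b ^+ 2)%:C by rewrite mulmx1 norm2_sq.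
have := @qformB _ _ 1%:M M%:C (X *m v) v _ _ _ _ (conjc_real M) E1 E2 E3 E4.
rewrite mulmx1 -norm2_sq; set e := norm2 _ => E.
have ab : a ^+ 2 <= (M * b) ^+ 2.
  rewrite ler_sqr ?nnegrE ?norm2_ge0//; last first.
    by rewrite mulr_ge0// ?norm2_ge0 ?ltW.
  exact: XM.
clearbody q a b e.
(* [e] is the norm of [X v - M v]; the second summand is nonnegative by [ab]. *)
have Me : (M * 2)%:C * (M%:C * (b ^+ 2)%:C - q) =
    (e ^+ 2 + ((M * b) ^+ 2 - a ^+ 2))%:C.
  transitivity ((e ^+ 2)%:C + ((M * b) ^+ 2 - a ^+ 2)%:C); last by simpc.
  by rewrite E; case: q {E1 E2 E3 E4 E} => q1 q2; simpc; congr (_ +i* _); ring.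
have M2 : 0 < (M * 2)%:C :> R[i] by rewrite ltcR mulr_gt0.
by rewrite -(pmulr_rge0 _ M2) Me ler0c addr_ge0 ?sqr_ge0// subr_ge0.
Qed.

Lemma psd_bounded (R : realType) m (X : 'M[R[i]]_m) : X \is hermsymmx ->
  exists2 lam : R, 0 < lam & psdmx (lam%:C%:M - X).
Proof.
move=> Xh; exists (Num.max 1 (spectral_norm X)); first by rewrite lt_max ltr01.
apply: psd_norm_bound => //; first by rewrite lt_max ltr01.
move=> v; apply: le_trans (spectral_normP _ _) _.
by rewrite ler_wpM2r ?norm2_ge0// le_max lexx orbT.
Qed.

(** With [S = f0^(1/2)], this turns the norm of the scaled symbol into an
    inequality against [f0] itself: conjugate [M - S^-1 Y S^-1] by [S]. *)
Lemma psd_unscale (R : realType) m (S Y : 'M[R[i]]_m) (M : R) :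
  S^t* = S -> S \in unitmx -> psdmx Y -> 0 < M ->
  spectral_norm (invmx S *m Y *m invmx S) <= M ->
  psdmx (M%:C *: (S *m S) - Y).
Proof.
move=> Sh Su Yp M0 YM.
have iSh : (invmx S)^t* = invmx S by rewrite trmx_inv map_invmx Sh.
have YE : Y = S *m (invmx S *m Y *m invmx S) *m S.
  by rewrite (mulmxA S) (mulmxA S) mulmxV// mul1mx -mulmxA mulVmx// mulmx1.
have : psdmx (M%:C%:M - invmx S *m Y *m invmx S).
  apply: psd_norm_bound => //.
    by have [] := psd_congr (invmx S) Yp; rewrite iSh.
  move=> v; apply: le_trans (spectral_normP _ _) _.
  by rewrite ler_wpM2r ?norm2_ge0.
move=> /(psd_congr S); rewrite Sh.
by rewrite mulmxBr mulmxBl mul_mx_scalar -scalemxAl -YE.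
Qed.

Lemma sqrtmx_unit (R : realType) m (X : 'M[R[i]]_m) :
  psdmx X -> X \in unitmx -> sqrtmx X \in unitmx.
Proof.
move=> /sqrtmxP[_]; move: (sqrtmx X) => S SX Xu.
suff : S *m (S *m invmx X) = 1%:M by case/mulmx1_unit.
by rewrite mulmxA SX mulmxV.
Qed.

(** * Trigonometric polynomials and their mean value *)

(** Continuity is required of the two real components, which is the form that
    the componentwise integral [cintegral] consumes. *)
Definition ccontinuous (R : realType) (g : R -> R[i]) : Prop :=
  continuous (fun t => complex.Re (g t)) /\
  continuous (fun t => complex.Im (g t)).

Lemma ccontinuous_cst (R : realType) (c : R[i]) : ccontinuous (fun _ : R => c).
Proof. by split=> t; exact: cvg_cst. Qed.

Lemma ccontinuousD (R : realType) (g h : R -> R[i]) :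
  ccontinuous g -> ccontinuous h -> ccontinuous (fun t => g t + h t).
Proof.
move=> [g1 g2] [h1 h2]; split.
  rewrite (_ : (fun t => _) = fun t => complex.Re (g t) + complex.Re (h t)).
    by move=> t; apply: cvgD; [exact: g1|exact: h1].
  by apply/funext => t; case: (g t) (h t) => ? ? [].
rewrite (_ : (fun t => _) = fun t => complex.Im (g t) + complex.Im (h t)).
  by move=> t; apply: cvgD; [exact: g2|exact: h2].
by apply/funext => t; case: (g t) (h t) => ? ? [].
Qed.

Lemma ccontinuousM (R : realType) (g h : R -> R[i]) :
  ccontinuous g -> ccontinuous h -> ccontinuous (fun t => g t * h t).
Proof.
move=> [g1 g2] [h1 h2]; split.
  rewrite (_ : (fun t => _) = fun t => complex.Re (g t) * complex.Re (h t)
     - complex.Im (g t) * complex.Im (h t)).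
    by move=> t; apply: cvgB; apply: cvgM;
      [exact: g1|exact: h1|exact: g2|exact: h2].
  by apply/funext => t; case: (g t) (h t) => ? ? [].
rewrite (_ : (fun t => _) = fun t => complex.Re (g t) * complex.Im (h t)
     + complex.Im (g t) * complex.Re (h t)).
  by move=> t; apply: cvgD; apply: cvgM;
    [exact: g1|exact: h2|exact: g2|exact: h1].
by apply/funext => t; case: (g t) (h t) => ? ? [].
Qed.

Lemma ccontinuous_sum (R : realType) (I : Type) (s : seq I)
    (g : I -> R -> R[i]) :
  (forall i, ccontinuous (g i)) -> ccontinuous (fun t => \sum_(i <- s) g i t).
Proof.
move=> gc; elim: s => [|i s IH].
  rewrite (_ : (fun t => _) = fun=> 0); first exact: ccontinuous_cst.
  by apply/funext => t; rewrite big_nil.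
rewrite (_ : (fun t => _) = fun t => g i t + \sum_(j <- s) g j t).
  exact: ccontinuousD.
by apply/funext => t; rewrite big_cons.
Qed.

Lemma ccontinuous_expi (R : realType) (k : R) :
  ccontinuous (fun t => expi (k * t)).
Proof.
have kc : continuous (fun t : R => k * t).
  by move=> t; apply: cvgM; [exact: cvg_cst|exact: cvg_id].
by split=> t; rewrite /expi/=; apply: (continuous_comp (kc t));
  [exact: continuous_cos|exact: continuous_sin].
Qed.

Lemma trigpoly_continuous (R : realType) d (f : R -> 'M[R[i]]_d) k l :
  trigpoly f -> ccontinuous (fun t => f t k l).
Proof.
move=> [r [c fE]].
rewrite (_ : (fun t => _) = fun t => \sum_(j < (2 * r).+1)
   expi ((j%:Z - r%:Z)%:~R * t) * c (j%:Z - r%:Z) k l).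
  apply: ccontinuous_sum => j; apply: ccontinuousM; last exact: ccontinuous_cst.
  exact: ccontinuous_expi.
by apply/funext => t; rewrite fE summxE; apply: eq_bigr => j _; rewrite mxE.
Qed.

Lemma trigpoly_periodic (R : realType) d (f : R -> 'M[R[i]]_d) t :
  trigpoly f -> f (t - 2 * pi) = f t.
Proof.
move=> [r [c fE]]; rewrite !fE; apply: eq_bigr => j _; congr (_ *: _).
set k := (_ - _)%R : int.
suff k1 : expi (k%:~R * (2 * pi)) = 1 :> R[i].
  by rewrite mulrBr expiD -[X in _ * X]conj_expi k1 rmorph1 mulr1.
clearbody k; case: k => k.
  by rewrite -pmulrn (expiMn (2 * pi)) expi_2pi expr1n.
rewrite NegzE mulrNz mulNr -conj_expi -pmulrn (expiMn (2 * pi)) expi_2pi.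
by rewrite expr1n rmorph1.
Qed.

(** Presents the form as a finite linear combination of entries, through which
    continuity and integration pass term by term. *)
Lemma qform_sumE (C : numClosedFieldType) m (X : 'M[C]_m) (v : 'cV_m) :
  (v^t* *m X *m v) 0 0 = \sum_k \sum_l (Num.conj (v k 0) * v l 0) * X k l.
Proof.
rewrite exchange_big mxE; apply: eq_bigr => l _.
rewrite mxE mulr_suml; apply: eq_bigr => k _.
by rewrite !mxE mulrAC.
Qed.

Lemma ccontinuous_qform (R : realType) d (f : R -> 'M[R[i]]_d)
    (v : 'cV[R[i]]_d) :
  trigpoly f -> ccontinuous (fun t => (v^t* *m f t *m v) 0 0).
Proof.
move=> ft; under eq_fun do rewrite qform_sumE.
do 2 (apply: ccontinuous_sum => ?); apply: ccontinuousM.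
  exact: ccontinuous_cst.
exact: trigpoly_continuous.
Qed.

Lemma continuous_integrable_period (R : realType) (g : R -> R) : continuous g ->
  (@lebesgue_measure R).-integrable `[- pi, pi]%classic (EFin \o g).
Proof.
by move=> gc; apply: continuous_compact_integrable;
  [exact: segment_compact|exact: continuous_subspaceT].
Qed.

Local Notation pint := (cintegral `[- pi, pi]%classic).

Lemma cintegralD (R : realType) (g h : R -> R[i]) :
  ccontinuous g -> ccontinuous h ->
  pint (fun t => g t + h t) = pint g + pint h.
Proof.
move=> [g1 g2] [h1 h2].
have E (x y x' y' : R) : (x +i* y) + (x' +i* y') = (x + x') +i* (y + y') by [].
rewrite /cintegral E -!RintegralD//; try exact: continuous_integrable_period.
by congr (_ +i* _); apply: eq_Rintegral => t _; case: (g t) (h t) => ? ? [].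
Qed.

Lemma cintegralZ (R : realType) (c : R[i]) (g : R -> R[i]) :
  ccontinuous g -> pint (fun t => c * g t) = c * pint g.
Proof.
move=> [g1 g2]; case: c => a b.
have E (x y : R) : (a +i* b) * (x +i* y) = (a * x - b * y) +i* (a * y + b * x).
  by [].
have Zc (u : R) (h : R -> R) : continuous h -> continuous (fun t => u * h t).
  by move=> hc t; apply: cvgM; [exact: cvg_cst|exact: hc].
rewrite /cintegral E -!RintegralZl//; try exact: continuous_integrable_period.
rewrite -RintegralB//; try by apply: continuous_integrable_period; exact: Zc.
rewrite -RintegralD//; try by apply: continuous_integrable_period; exact: Zc.
by congr (_ +i* _); apply: eq_Rintegral => t _; case: (g t).
Qed.

Lemma cintegral_sum (R : realType) (I : Type) (s : seq I) (g : I -> R -> R[i]) :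
  (forall i, ccontinuous (g i)) ->
  pint (fun t => \sum_(i <- s) g i t) = \sum_(i <- s) pint (g i).
Proof.
move=> gc; elim: s => [|i s IH].
  (* As a multiple of 0, the zero function integrates to 0 by [cintegralZ]. *)
  rewrite big_nil (_ : (fun t => _) = fun=> 0 * 0).
    by rewrite (@cintegralZ _ 0 (fun=> 0)) ?mul0r//; exact: ccontinuous_cst.
  by apply/funext => t; rewrite big_nil mul0r.
rewrite big_cons -IH -cintegralD//; last exact: ccontinuous_sum.
by congr cintegral; apply/funext => t; rewrite big_cons.
Qed.

Lemma cintegral_ge0 (R : realType) (g : R -> R[i]) :
  (forall t, 0 <= g t) -> 0 <= pint g.
Proof.
move=> g0; rewrite lecE/= (_ : \int[_]_(t in _) _ = 0)/=.
  by rewrite eqxx/= Rintegral_ge0// => t _; move: (g0 t);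
    rewrite lecE => /andP[].
rewrite (@eq_Rintegral _ _ _ _ _ (fun=> 0)) ?Rintegral_cst ?mul0r//.
by move=> t _; move: (g0 t); rewrite lecE => /andP[/eqP].
Qed.

Lemma fourier_coef0E (R : realType) d (f : R -> 'M[R[i]]_d) k l :
  fourier_coef f 0 k l =
  ((2 * pi)^-1)%:C * cintegral `[- pi, pi]%classic (fun t => f t k l).
Proof.
rewrite mxE; congr (_ * _); congr cintegral; apply/funext => t.
by rewrite mul0r oppr0 expi0 mulr1.
Qed.

Lemma cintegral_conj (R : realType) (g : R -> R[i]) : ccontinuous g ->
  cintegral `[- pi, pi]%classic (fun t => Num.conj (g t)) =
  Num.conj (cintegral `[- pi, pi]%classic g).
Proof.
move=> [g1 g2]; rewrite /cintegral.
have E (x y : R) : Num.conj (x +i* y) = x +i* (-1 * y) by rewrite mulN1r.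
rewrite E -RintegralZl//; last exact: continuous_integrable_period.
congr (_ +i* _); apply: eq_Rintegral => t _; case: (g t) => ? ? //=.
by rewrite mulN1r.
Qed.

(** By linearity of the integral [v^* f0 v] is the mean value of the
    nonnegative function [v^* f v]. *)
Lemma psd_fourier_coef0 (R : realType) d (f : R -> 'M[R[i]]_d) :
  trigpoly f -> (forall t, psdmx (f t)) -> psdmx (fourier_coef f 0).
Proof.
move=> ft fp.
have c0 : 0 <= (2 * pi : R)^-1 by rewrite invr_ge0 mulr_ge0// pi_ge0.
split.
  rewrite hermsymmxE; apply/eqP/matrixP => k l.
  rewrite [RHS]mxE [X in _ = _ X]mxE !fourier_coef0E.
  rewrite rmorphM -[X in _ = _ * X]cintegral_conj; last first.
    exact: trigpoly_continuous.
  congr (_ * _); first by apply/esym; exact: conjc_real.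
  congr cintegral; apply/funext => t.
  have [/[1!hermsymmxE]/eqP fh _] := fp t.
  by rewrite [in LHS]fh mxE mxE.
move=> v; rewrite qform_sumE.
have -> : \sum_k \sum_l (Num.conj (v k 0) * v l 0) * fourier_coef f 0 k l =
  ((2 * pi)^-1)%:C *
    cintegral `[- pi, pi]%classic (fun t => (v^t* *m f t *m v) 0 0).
  rewrite (_ : (fun t => _) = fun t => \sum_k \sum_l
    (Num.conj (v k 0) * v l 0) * f t k l); last first.
    by apply/funext => t; rewrite qform_sumE.
  have fc k l : ccontinuous (fun t => Num.conj (v k 0) * v l 0 * f t k l).
    by apply: ccontinuousM; [exact: ccontinuous_cst|exact: trigpoly_continuous].
  rewrite cintegral_sum => [|k]; last exact: ccontinuous_sum.
  rewrite mulr_sumr; apply: eq_bigr => k _.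
  rewrite cintegral_sum// mulr_sumr; apply: eq_bigr => l _.
  rewrite fourier_coef0E cintegralZ; last exact: trigpoly_continuous.
  exact: mulrCA.
by apply: mulr_ge0; [rewrite ler0c|apply: cintegral_ge0 => t; exact: (fp t).2].
Qed.

(** * From an essential bound to a pointwise bound *)

(** If [h t < 0] then [h] is negative on a nonempty open subinterval of
    [(a, b)], even when [t] is an endpoint, and such an interval is not
    negligible. *)
Lemma ae_ge0_continuous (R : realType) (a b : R) (h : R -> R) : a < b ->
  continuous h ->
  (\forall t \ae mrestr (@lebesgue_measure R)
     (measurable_itv (`]a, b[ : interval R)), 0 <= h t) ->
  forall t, a <= t <= b -> 0 <= h t.
Proof.
move=> ab hc [N [mN N0 hN]] t /andP[at_ tb].
rewrite leNgt; apply/negP => ht.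
have : nbhs t [set s | h s < 0]%classic by exact: (cvgr_lt _ (hc t)).
move=> /nbhs_ballP[e /= e0 he].
(* Clipped to [(a, b)], the interval stays nonempty when [t] is an endpoint. *)
pose lo := Num.max a (t - e); pose hi := Num.min b (t + e).
have lohi : lo < hi.
  by rewrite lt_min !gt_max ab /=; apply/and3P; split; lra.
have sub : (`]lo, hi[ `<=` N `&` `]a, b[)%classic.
  move=> s /=; rewrite !in_itv/= gt_max lt_min.
  move=> /andP[/andP[s1 s2] /andP[s3 s4]].
  split; last by rewrite s1 s3.
  apply: hN => /=; apply/negP; rewrite -ltNge; apply: he.
  by rewrite /ball/= ltr_distlC; apply/andP; split; lra.
have := le_measure (@lebesgue_measure R) _ _ sub.
rewrite !inE => /(_ (measurable_itv _) (measurableI _ _ mN (measurable_itv _))).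
rewrite [X in (_ <= X)%E -> _]N0.
rewrite [X in (X <= _)%E -> _](lebesgue_measure_itv `]lo, hi[%R)/= lte_fin lohi.
by rewrite -EFinB lee_fin subr_le0 leNgt lohi.
Qed.

Lemma hermmx_qform_real (C : numClosedFieldType) m (X : 'M[C]_m) (v : 'cV_m) :
  X^t* = X -> Num.conj ((v^t* *m X *m v) 0 0) = (v^t* *m X *m v) 0 0.
Proof.
move=> Xh.
transitivity (((v^t* *m X *m v)^t* ) 0 0).
  by rewrite [RHS]mxE [X in _ = _ X]mxE.
by rewrite !trmx_mul !map_mxM Xh trmxCK mulmxA.
Qed.

Lemma psd_ReP (R : realType) m (X : 'M[R[i]]_m) : X \is hermsymmx ->
  (forall v : 'cV_m, 0 <= complex.Re ((v^t* *m X *m v) 0 0)) -> psdmx X.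
Proof.
move=> Xh Xp; split=> // v; move: Xh (Xp v).
rewrite hermsymmxE eq_sym => /eqP Xh.
have := @hermmx_qform_real _ _ X v Xh.
case: (_ 0 0) => x y [/eqP yy] x0.
rewrite lecE/= x0 andbT -[y == 0](mulrn_eq0 _ 2)/= mulr2n.
by rewrite -{1}(eqP yy) addNr.
Qed.

(** [psd_unscale] gives the inequality almost everywhere; it extends to the
    closed interval by continuity of [v^* (M f0 - f) v], one [v] at a time. *)
Lemma psd_symbol_bound (R : realType) d (f : R -> 'M[R[i]]_d) (M : R) :
  trigpoly f -> (forall t, psdmx (f t)) -> fourier_coef f 0 \in unitmx ->
  0 < M ->
  (norm_infty (fun t => invmx (sqrtmx (fourier_coef f 0)) *m f t
                  *m invmx (sqrtmx (fourier_coef f 0))) <= M%:E)%E ->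
  forall t, - pi <= t <= pi -> psdmx (M%:C *: fourier_coef f 0 - f t).
Proof.
move=> ft fp f0u M0 /ess_supP aeM t tpi.
have f0p := psd_fourier_coef0 ft fp.
set f0 := fourier_coef f 0 in aeM f0u f0p *.
have Su := sqrtmx_unit f0p f0u.
have [[Sh _] SS] := sqrtmxP f0p.
have Sht : (sqrtmx f0)^t* = sqrtmx f0 by apply/esym/eqP; rewrite -hermsymmxE.
have boundp s :
    spectral_norm (invmx (sqrtmx f0) *m f s *m invmx (sqrtmx f0)) <= M ->
    psdmx (M%:C *: f0 - f s).
  by move=> /(psd_unscale Sht Su (fp s) M0); rewrite SS.
apply: psd_ReP.
  have [/[1!hermsymmxE]/eqP f0h _] := f0p.
  have [/[1!hermsymmxE]/eqP fh _] := fp t.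
  rewrite hermsymmxE linearB linearZ/= map_mxB map_mxZ -f0h -fh.
  by apply/eqP; congr (_ *: _ - _); apply/esym; exact: conjc_real.
move=> v; pose g (s : R) := (v^t* *m (M%:C *: f0 - f s) *m v) 0 0.
have [gc _] : ccontinuous g.
  rewrite (_ : g = fun s => M%:C * (v^t* *m f0 *m v) 0 0
                            + (-1) * (v^t* *m f s *m v) 0 0).
    apply: ccontinuousD; first exact: ccontinuous_cst.
    by apply: ccontinuousM; [exact: ccontinuous_cst|exact: ccontinuous_qform].
  by apply/funext => s; rewrite mulN1r; exact: qform_scaleB.
have pipi : - pi < pi :> R by rewrite gt0_cp// pi_gt0.
apply: (ae_ge0_continuous pipi gc _ tpi).
apply: filterS aeM => s /=; rewrite lee_fin => /boundp[_ /(_ v)].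
by rewrite lecE => /andP[].
Qed.

(** When the norm is [0] its inverse is [+oo] and [omega] is unconstrained;
    [1 / omega] then serves as a positive upper bound.  An infinite or negative
    value of [m] makes the right-hand side nonpositive, against [0 < omega]. *)
Lemma relaxation_bound (R : realType) (omega : R) (m : \bar R) : 0 < omega ->
  (omega%:E < 2%:E / m)%E ->
  exists M : R, [/\ 0 < M, omega * M < 2 & (m <= M%:E)%E].
Proof.
move=> omega0; case: m => [r| |].
- rewrite inver; case: eqVneq => [->|r0] h.
    exists omega^-1; rewrite invr_gt0 omega0 mulfV ?gt_eqF//; split => //.
      by rewrite ltr1n.
    by rewrite lee_fin invr_ge0 ltW.
  move: h; rewrite -EFinM lte_fin => h.
  have rp : 0 < r.
    by rewrite -invr_gt0 -(pmulr_rgt0 _ (@ltr0Sn R 1)) (lt_trans omega0).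
  by exists r; split=> //; rewrite -ltr_pdivlMr.
- by rewrite invey mule0 lte_fin ltNge (ltW omega0).
- by rewrite inveNy gt0_muleNy ?lte_fin.
Qed.

Unset Implicit Arguments.

Theorem theorem3 (R : realType) (d : nat) (f : R -> 'M[complex R]_d)
    (omega : R) :
  (0 < d)%N ->
  trigpoly f ->
  (forall t : R, psdmx (f t)) ->
  fourier_coef f 0 \in unitmx ->
  0 < omega ->
  (omega%:E < 2%:E / norm_infty (fun t : R =>
                invmx (sqrtmx (fourier_coef f 0)) *m f t
                  *m invmx (sqrtmx (fourier_coef f 0))))%E ->
  exists2 a_post : R, 0 < a_post &
    forall n : nat, (0 < n)%N ->
    forall x : 'cV[complex R]_(n * d),
      let A := block_circulant n f in
      let V := jacobi_post n f omega in
      norm_mx A (V *m x) ^+ 2 <=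
        norm_mx A x ^+ 2 - a_post * norm_mx (A *m A) x ^+ 2.
Proof.
move=> d0 ft fp f0u omega0 /(relaxation_bound omega0)[M [M0 omM fM]].
have f0p := psd_fourier_coef0 ft fp.
have [lam lam0 lamP] := psd_bounded f0p.1.
exists (omega * (2 - omega * M) / lam) => [|n n0 x].
  by rewrite divr_gt0// mulr_gt0// subr_gt0.
apply: (jacobi_post_smoothing n0 d0 fp f0p f0u _ lamP lam0
  (ltW omega0) (ltW omM)).
move=> i; have := psd_symbol_bound ft fp f0u M0 fM.
have pi0 := @pi_gt0 R.
have n0R : 0 < n%:R :> R by rewrite ltr0n.
have th0 : 0 <= theta R n i by rewrite divr_ge0 ?mulr_ge0// ltW.
have th2 : theta R n i < 2 * pi.
  by rewrite ltr_pdivrMr// ltr_pM2l ?mulr_gt0// ltr_nat.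
(* Grid points lie in [0, 2 pi), the bound is known on [-pi, pi]. *)
move=> H; have [thpi|thpi] := leP (theta R n i) pi.
  by apply: H; lra.
by rewrite -(trigpoly_periodic _ ft); apply: H; lra.
Qed.
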